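(* Let $\mathbf{K}=\mathbf{K}^T$ be the Koopman operator with fixed lag time $T$ described in the context, with dominant eigenfunctions $v_1\equiv 1$ and $v_2$, and let the shift-scale map $\bar S$, the matrix $S$ and the relation between $\chi$ and $\bar\chi$ be as in the context. For generic $\bar\chi_0:\mathbf{X}\to\mathbb{R}$, i.e. containing components of $v_1$ and $v_2$, the iteration $$\bar\chi_{n+1}=\bar S(\mathbf{K}\bar\chi_n)$$ converges to the $\chi$-function (represented by its first component) $$\bar\chi=\lim_{n\to\infty}\bar\chi_n=\alpha v_1+\beta v_2$$ for some $\alpha,\beta\in\mathbb{R}$, which in turn solves the fixed-point problem $\bar\chi=\bar S(\mathbf{K}\bar\chi)$, i.e. $\chi=S\,\mathbf{K}\chi$ for $\chi=\begin{pmatrix}\bar\chi\\1-\bar\chi\end{pmatrix}$, where $S$ is the matrix associated with $\kappa=\mathbf{K}\bar\chi$.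
   Context: Process: $X=(X_t)_{t\ge0}$ is the reversible diffusion $\mathrm{d}X_t=b(X_t)\,\mathrm{d}t+\sigma\,\mathrm{d}B_t$ on $\mathbf{X}=\mathbb{R}^n$ with constant $\sigma\in\mathbb{R}^{n\times n}$, $b=-\nabla U$ for a smooth potential $U:\mathbf{X}\to\mathbb{R}$, and $B$ an $n$-dimensional Brownian motion. Koopman operator: for lag time $T$, $\mathbf{K}^T:L^\infty(\mathbf{X})\to L^\infty(\mathbf{X})$, $(\mathbf{K}^Tf)(x)=\mathbf{E}[f(X_T)\mid X_0=x]$. Its eigenfunctions $v_i\in L^\infty(\mathbf{X})$, $i=1,2,\dots$, satisfy $\mathbf{K}^Tv_i=\lambda_i(T)v_i$ with $\lambda_i(T)=\exp(Tq_i)$, $0=q_1>q_2\ge q_3\ge\dots$ and $v_1\equiv1$. The number $d$ of dominant eigenfunctions is chosen up to a spectral gap; here $d=2$, so $q_2>q_3$. The components of $\bar\chi_0$ refer to its eigendecomposition $\bar\chi_0=\sum_{i=1}^\infty a_iv_i$; containing components of $v_1$ and $v_2$ means $a_1\ne0$ and $a_2\neq0$. $\chi$-function: a function $\chi=(\chi_i)_{i=1}^d:\mathbf{X}\to\mathbb{R}^d$ with $0\le\chi_i\le1$, $\sum_i\chi_i=1$, satisfying $\chi=S\,\mathbf{K}\chi$ for an appropriately chosen matrix $S$ ($\mathbf{K}$ acting componentwise). For $d=2$ it is determined by its first component $\bar\chi=\chi_1$ via $\chi=\begin{pmatrix}\bar\chi\\1-\bar\chi\end{pmatrix}$. Shift-scale: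 for bounded continuous functions $\kappa\in C(\mathbf{X})$, $$\bar S(\kappa)=\frac{\kappa-\min(\kappa)}{\max(\kappa)-\min(\kappa)}.$$ Associated matrix: $S\in\mathbb{R}^{2\times2}$ (depending on $\kappa$) is the matrix satisfying $$S\begin{pmatrix}\kappa\\1-\kappa\end{pmatrix}=\begin{pmatrix}\bar S(\kappa)\\1-\bar S(\kappa)\end{pmatrix}.$$ *)

(* Defs.v *)
From HB Require Import structures.
From mathcomp Require Export all_boot all_order all_algebra.
From mathcomp Require Export all_classical all_reals all_analysis.
From mathcomp Require Export measurable_realfun ess_sup_inf.

Set Implicit Arguments.
Unset Strict Implicit.
Unset Printing Implicit Defensive.

Export Order.TTheory GRing.Theory Num.Theory.
Export numFieldNormedType.Exports.

Global Open Scope classical_set_scope.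
Global Open Scope ring_scope.

(* Borel sigma-algebra on real matrices, in particular on R^n = 'cV[R]_n. *)
HB.instance Definition _ (R : realType) (m n : nat) :=
  Measurable.copy 'M[R]_(m, n) (g_sigma_algebraType (@open 'M[R]_(m, n))).

Section euclidean.
Context {R : realType} {n : nat}.
Local Notation Rn := 'cV[R]_n.

(* The library has no n-dimensional Lebesgue measure; the values on boxes
   determine it uniquely on Borel sets. *)
Definition is_lebesgue (leb : {measure set Rn -> \bar R}) : Prop :=
  forall a b : Rn, (forall i, a i 0 <= b i 0) ->
    leb [set x : Rn | forall i, a i 0 <= x i 0 <= b i 0] =
    (\prod_i (b i 0 - a i 0))%:E.

Definition partial (i : 'I_n) (f : Rn -> R) (x : Rn) : R :=
  'D_(delta_mx i 0 : Rn) f x.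

Fixpoint is_Ck (k : nat) (f : Rn -> R) : Prop :=
  continuous f /\
  if k is k'.+1 then
    forall i, (forall x, derivable f x (delta_mx i 0 : Rn)) /\
              is_Ck k' (partial i f)
  else True.

Definition smooth (f : Rn -> R) : Prop := forall k, is_Ck k f.

Definition gradient (f : Rn -> R) (x : Rn) : Rn := \col_i partial i f x.

End euclidean.

Section diffusion.
Context {R : realType} {n : nat} {d : measure_display} {Om : measurableType d}.
Variable P : probability Om R.
Local Notation Rn := 'cV[R]_n.

(* The last field says that the coordinates (B_{t_{j+1}} - B_{t_j})_i are
   jointly independent in (i, j), with laws N(0, t_{j+1} - t_j). *)
Record brownian_motion (B : R -> Om -> Rn) : Prop := {
  bm_measurable : forall t : R, 0 <= t -> measurable_fun setT (B t) ;
  bm_start : \forall w \ae P, B 0 w = 0 ;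
  bm_continuous : \forall w \ae P, {within `[0, +oo[, continuous (B ^~ w)} ;
  bm_increments : forall (k : nat) (t : nat -> R) (A : 'I_k -> 'I_n -> set R),
    0 <= t 0%N -> (forall j, (j < k)%N -> t j < t j.+1) ->
    (forall j i, measurable (A j i)) ->
    P [set w | forall (j : 'I_k) (i : 'I_n),
                 A j i ((B (t j.+1) w - B (t j) w) i 0)] =
    (\prod_(j < k) \prod_(i < n)
       normal_prob 0 (Num.sqrt (t j.+1 - t j)) (A j i))%E }.

(* [X x] is the process dX = - grad U (X) dt + sigma dB started at [x].  The
   noise being additive, the stochastic integral is [sigma *m B t] and the
   equation is an ordinary integral equation for almost every path; the pathwise
   solution is a functional of B, so it need not be required to be adapted. *)
Record diffusion (U : Rn -> R) (sigma : 'M[R]_n) (B : R -> Om -> Rn)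
    (X : Rn -> R -> Om -> Rn) : Prop := {
  diff_measurable : forall (x : Rn) (t : R), 0 <= t ->
    measurable_fun setT (X x t) ;
  diff_kernel : forall (t : R) (A : set Rn), 0 <= t -> measurable A ->
    measurable_fun setT (fun x => P (X x t @^-1` A)) ;
  diff_continuous : forall x,
    \forall w \ae P, {within `[0, +oo[, continuous (X x ^~ w)} ;
  diff_equation : forall x, \forall w \ae P, forall t : R, 0 <= t ->
    X x t w = x
      + \col_i (\int[lebesgue_measure]_(s in `[0, t])
                  (- gradient U (X x s w)) i 0)
      + sigma *m B t w }.

(* Detailed balance for the transition kernels p_t(x, A) = P(X^x_t \in A). *)
Definition reversible (X : Rn -> R -> Om -> Rn) : Prop :=
  exists mu : {measure set Rn -> \bar R},
    [/\ sigma_finite setT mu, (0 < mu setT)%E &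
        forall (t : R) (A A' : set Rn), 0 <= t -> measurable A -> measurable A' ->
          (\int[mu]_(x in A) P (X x t @^-1` A') =
           \int[mu]_(x in A') P (X x t @^-1` A))%E].

(* E[f(X_t) | X_0 = x] *)
Definition koopman (X : Rn -> R -> Om -> Rn) (t : R) (f : Rn -> R) (x : Rn) : R :=
  fine ('E_P[fun w => f (X x t w)])%E.

End diffusion.

Section Linfty.
Context {R : realType} {n : nat}.
Local Notation Rn := 'cV[R]_n.
Variable leb : {measure set Rn -> \bar R}.

(* Elements of L^oo are represented by functions; equality in L^oo is equality
   almost everywhere. *)
Definition Linfty (f : Rn -> R) : Prop := f \in Lfun leb +oo%E.

Definition Linfty_cvg (f_ : nat -> Rn -> R) (f : Rn -> R) : Prop :=
  ('N[leb]_+oo[EFin \o (fun x => f_ k x - f x)%R])%E @[k --> \oo] --> 0%E.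

Definition Linfty_operator (K : (Rn -> R) -> Rn -> R) : Prop :=
  (forall f, Linfty f -> Linfty (K f)) /\
  (forall f g, Linfty f -> Linfty g ->
     f = g %[ae leb] -> K f = K g %[ae leb]).

(* The eigenfunctions v_1, v_2, ... and rates q_1, q_2, ... are indexed from 0. *)
Record dominant_spectrum (K : (Rn -> R) -> Rn -> R) (T : R)
    (q : nat -> R) (v : nat -> Rn -> R) : Prop := {
  spec_Linfty : forall i, Linfty (v i) ;
  spec_neq0 : forall i, ~ (v i = cst 0 %[ae leb]) ;
  spec_eigen : forall i, K (v i) = (fun x => expR (T * q i) * v i x) %[ae leb] ;
  spec_v1 : v 0%N = cst 1 %[ae leb] ;
  spec_q1 : q 0%N = 0 ;
  spec_q12 : q 1%N < q 0%N ;
  spec_q_noninc : forall i, q i.+1 <= q i ;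
  spec_gap : q 2%N < q 1%N }.

Definition eigendecomposition (v : nat -> Rn -> R) (a : nat -> R)
    (f : Rn -> R) : Prop :=
  Linfty_cvg (fun N x => \sum_(i < N) a i * v i x) f.

(* On L^oo the extrema are the essential ones; on bounded continuous functions
   these are the usual infimum and supremum, see [shift_scale_continuous]. *)
Definition shift_scale (k : Rn -> R) (x : Rn) : R :=
  let m := fine (ess_infr leb k) in
  let M := fine (ess_supr leb k) in
  (k x - m) / (M - m).

Definition iterates (K : (Rn -> R) -> Rn -> R) (f0 : Rn -> R) (k : nat) :
  Rn -> R := iter k (fun f => shift_scale (K f)) f0.

Definition componentwise {p : nat} (K : (Rn -> R) -> Rn -> R)
  (F : Rn -> 'cV[R]_p) (x : Rn) : 'cV[R]_p := \col_i K (fun y => F y i 0) x.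

Definition solves_chi {p : nat} (K : (Rn -> R) -> Rn -> R) (S : 'M[R]_p)
  (chi : Rn -> 'cV[R]_p) : Prop :=
  \forall x \ae leb, chi x = S *m componentwise K chi x.

Definition chi_function {p : nat} (K : (Rn -> R) -> Rn -> R)
    (chi : Rn -> 'cV[R]_p) : Prop :=
  [/\ \forall x \ae leb, forall i, 0 <= chi x i 0 <= 1,
      \forall x \ae leb, \sum_i chi x i 0 = 1 &
      exists S : 'M[R]_p, solves_chi K S chi].

Definition chi_of (f : Rn -> R) (x : Rn) : 'cV[R]_2 :=
  \col_i if i == 0 then f x else 1 - f x.

Definition associated_matrix (k : Rn -> R) (S : 'M[R]_2) : Prop :=
  \forall x \ae leb, S *m chi_of k x = chi_of (shift_scale k) x.

End Linfty.

Section shift_scale_on_continuous_functions.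
Context {R : realType} {n : nat}.
Local Notation Rn := 'cV[R]_n.
Variable leb : {measure set Rn -> \bar R}.

Lemma box_measurable (a b : Rn) :
  measurable [set x : Rn | forall i, a i 0 <= x i 0 <= b i 0].
Proof.
have cl : closed [set x : Rn | forall i, a i 0 <= x i 0 <= b i 0].
  rewrite (_ : [set x : Rn | _] =
      \bigcap_(i in [set: 'I_n]) ((fun x : Rn => x i 0) @^-1` `[a i 0, b i 0])).
    apply: closed_bigI => i _; apply: closed_comp.
      by move=> x _; exact: coord_continuous.
    exact: interval_closed.
  apply/seteqP; split => [x h i _|x h i] /=; first by rewrite in_itv/=.
  by have := h i I; rewrite /= in_itv.
rewrite -(setCK [set x : Rn | _]); apply: measurableC.
apply: sub_sigma_algebra; exact: closed_openC.
Qed.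

Lemma ess_supr_continuous (k : Rn -> R) : is_lebesgue leb -> continuous k ->
  ess_supr leb k = ereal_sup (range (EFin \o k)).
Proof.
move=> hleb kc; apply/eqP; rewrite eq_le; apply/andP; split.
  by apply/ess_supP; apply: nearW => x; apply: ereal_sup_ubound; exists x.
apply/ereal_supP => _ [x0 _ <-]; rewrite leNgt; apply/negP => /= sk.
have [s [ks sx0]] : exists s : R,
    (\forall x \ae leb, k x <= s) /\ s < k x0.
  have hs := ess_sup_ge leb (EFin \o k).
  case: (ess_supr leb k) sk hs => [s| |] // sk hs.
    by exists s; split; [apply: filterS hs => x /=; rewrite lee_fin|].
  exists (k x0 - 1); split; last by rewrite ltrBlDr ltrDl.
  by apply: filterS hs => x /=; rewrite leeNy_eq.
have /(_ _)/nbhs_ballP[] := kc x0 [set y | s < y].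
  by apply: open_nbhs_nbhs; split; [exact: open_gt|].
move=> e /= e0 he.
pose a : Rn := \col_i (x0 i 0 - e / 2); pose b : Rn := \col_i (x0 i 0 + e / 2).
have ab i : a i 0 < b i 0 by rewrite !mxE ltrD2l gtrN // divr_gt0.
have : leb [set x : Rn | forall i, a i 0 <= x i 0 <= b i 0] = 0%E.
  apply/negligibleP; first exact: box_measurable.
  apply: negligibleS ks => x /= hx; apply/negP; rewrite -ltNge; apply: he.
  split => // i j; rewrite (ord1 j); have := hx i; rewrite !mxE => /andP[h1 h2].
  rewrite /ball /= ltr_distlC.
  have e2 : e / 2 < e by rewrite ltr_pdivrMr // ltr_pMr // ltr1n.
  rewrite (lt_le_trans _ h1) ?(le_lt_trans h2) //; first by rewrite ltrD2l.
  by rewrite ltrD2l ltrN2.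
rewrite hleb; last by move=> i; exact/ltW.
by move=> [] /eqP; rewrite gt_eqF // prodr_gt0 // => i _; rewrite subr_gt0.
Qed.

Lemma ess_infr_continuous (k : Rn -> R) : is_lebesgue leb -> continuous k ->
  ess_infr leb k = ereal_inf (range (EFin \o k)).
Proof.
move=> hleb kc; rewrite ess_infEN /ereal_inf; congr (- _)%E.
rewrite (_ : (\- (EFin \o k))%E = EFin \o (fun x => - k x)); last exact/funext.
rewrite ess_supr_continuous //; last by move=> x; exact: (continuousN (kc x)).
by rewrite image_comp.
Qed.

Lemma shift_scale_continuous (k : Rn -> R) : is_lebesgue leb -> continuous k ->
  has_ubound (range k) -> has_lbound (range k) ->
  shift_scale leb k = fun x =>
    (k x - inf (range k)) / (sup (range k) - inf (range k)).
Proof.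
move=> hleb kc ub lb; apply/funext => x; rewrite /shift_scale.
rewrite ess_supr_continuous // ess_infr_continuous // -!(image_comp k EFin).
have r0 : range k !=set0 by exists (k 0), 0.
by rewrite ereal_sup_EFin // ereal_inf_EFin.
Qed.
End shift_scale_on_continuous_functions.

(* Main.v *)
Require Import Defs.
From mathcomp Require Import ring lra.
(** All that matters about the Koopman operator K is that it is a Markov operator
on L^oo: linear, K 1 = 1, and a contraction for the essential sup norm.

Let l_i = exp (T q_i), so that K v_i = l_i v_i and v_0 = 1.  Contractivity lets K^m be
applied term by term to chi0 = sum_i a_i v_i, which gives
  K^m chi0 = a_0 + l_1^m a_1 v_1 + sum_(i >= 2) l_i^m a_i v_i.
The only analytic difficulty is to see that the tail is O(l_2^m): a bound on
its norm before K^m is applied is useless, since K^m need not shrink it, and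
the series need not converge absolutely.  But the weights l_i^m decrease in i,
and the partial sums of sum_i a_i v_i are uniformly bounded because they
converge in L^oo; Abel summation ([abel_sum_le]) then bounds the weighted tail
by its first weight l_2^m times a constant ([power_expansion]).  Because
l_2 < l_1, the functions l_1^-m (K^m chi0 - a_0) converge in L^oo to
g = a_1 v_1 ([rescaled_cvg]).

The shift-scale map ignores positive affine changes of its argument
([shift_scale_affine]) and is continuous in L^oo at functions that are not
a.e. constant ([shift_scale_cvg]).  The first property and K 1 = 1 allow the
inner shift-scales to be removed, so that the m-th iterate is the shift-scale of
K^m chi0 ([iteratesE]), hence of l_1^-m (K^m chi0 - a_0); the second property
then gives the limit, the shift-scale of g ([iterates_cvg]), an affine function
of v_1.  It remains to know that no division by zero occurs: v_1 is not
constant, since its eigenvalue is not 1 ([osc_v1]), and K^m chi0 is never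
constant, as otherwise all later rescaled powers, and hence g, would be
constant ([osc_iter]).

The limit is a fixed point because g is an eigenfunction with positive
eigenvalue ([eigenfunction_fixed_point]).  Finally, for a nonconstant function f
the functions f and 1 - f are linearly independent, which yields the existence
and uniqueness of the associated matrix ([associated_matrix_exists],
[mul_chi_of_inj]). *)

Set Implicit Arguments.
Unset Strict Implicit.
Unset Printing Implicit Defensive.

(** * Two facts on real sequences *)

(** Abel summation: writing b_i as a difference of partial sums moves the
differences onto the weights, where they are nonnegative and telescope. *)
Lemma abel_sum_le (R : realDomainType) (c b : nat -> R) (C : R) :
  (forall i, 0 <= c i) -> (forall i, c i.+1 <= c i) ->
  (forall N, `|\sum_(i < N) b i| <= C) ->
  forall N, `|\sum_(i < N) c i * b i| <= c 0%N * C.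
Proof.
move=> c0 cS bC N.
(* Keeping the boundary term c_N B_N on the left makes the bound inductive. *)
suff H : `|\sum_(i < N) c i * b i - c N * \sum_(i < N) b i| <= (c 0%N - c N) * C.
  rewrite -[X in `|X|](subrK (c N * \sum_(i < N) b i)).
  rewrite (le_trans (ler_normD _ _))//.
  have : `|c N * \sum_(i < N) b i| <= c N * C.
    by rewrite normrM (ger0_norm (c0 N)) ler_wpM2l.
  by move=> h; rewrite (le_trans (lerD H h))// -mulrDl subrK.
elim: N => [|N IH]; first by rewrite !big_ord0 mulr0 subrr normr0 subrr mul0r.
have -> : \sum_(i < N.+1) c i * b i - c N.+1 * \sum_(i < N.+1) b i =
    (\sum_(i < N) c i * b i - c N * \sum_(i < N) b i) +
    (c N - c N.+1) * \sum_(i < N.+1) b i.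
  rewrite !big_ord_recr/=; ring.
rewrite (le_trans (ler_normD _ _))//.
have -> : (c 0%N - c N.+1) * C = (c 0%N - c N) * C + (c N - c N.+1) * C by ring.
by rewrite lerD// normrM ger0_norm ?subr_ge0// ler_wpM2l ?subr_ge0.
Qed.

Lemma cvg_dist_le (R : realType) (u e : nat -> R) (l : R) :
  (forall k, `|u k - l| <= e k) -> e k @[k --> \oo] --> 0 ->
  u k @[k --> \oo] --> l.
Proof.
move=> ue e0; apply/subr_cvg0; apply/norm_cvg0P.
by apply: (squeeze_cvgr _ (cvg_cst 0) e0); apply: nearW => k; rewrite normr_ge0 ue.
Qed.

(** * Essential extrema and the shift-scale map *)

Section essential_extrema.
Context {R : realType} {n : nat}.
Local Notation Rn := 'cV[R]_n.
Context (leb : {measure set Rn -> \bar R}).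
Implicit Types f g : Rn -> R.

(** A bound on the essential sup norm, phrased pointwise so that estimates combine
by real arithmetic at almost every point instead of in the extended reals. *)
Definition ae_bounded f (c : R) := \forall x \ae leb, `|f x| <= c.

Lemma ae_eqTP f g : f = g %[ae leb] <-> \forall x \ae leb, f x = g x.
Proof. by split; apply: filterS => x; [apply|move=> ->]. Qed.

Lemma Lnormy_le f c : (0 <= c)%E ->
  (('N[leb]_+oo[EFin \o f] <= c)%E <-> \forall x \ae leb, (`|f x|%:E <= c)%E).
Proof.
move=> c0; rewrite unlock; case: ifPn => [_|h]; first by split => /ess_supP.
split=> // _; exists setT; split => //.
by apply/eqP; rewrite eq_le measure_ge0 andbT leNgt.
Qed.

Lemma LinftyP f : Linfty leb f <->
  measurable_fun setT f /\ exists c, ae_bounded f c.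
Proof.
rewrite /Linfty; split.
  move=> h; have := sub_Lfun_mfun h; rewrite inE/= => mf.
  have := sub_Lfun_finLfun h; rewrite inE /finite_norm/= => nf.
  split => //; exists (fine ('N[leb]_+oo[EFin \o f])%E).
  have := (Lnormy_le f (Lnorm_ge0 leb +oo%E (EFin \o f))).1 (lexx _).
  by apply: filterS => x; rewrite -[X in (_ <= X)%E]fineK ?lee_fin// ge0_fin_numE// Lnorm_ge0.
move=> [mf [c fc]]; rewrite inE/=; apply/andP; split; first by rewrite inE.
rewrite inE/= /finite_norm; apply: (@le_lt_trans _ _ (Num.max 0 c)%:E); last exact: ltry.
apply/Lnormy_le; first by rewrite lee_fin le_max lexx.
by apply: filterS fc => x h; rewrite lee_fin le_max h orbT.
Qed.

Lemma Linfty_lin f g (a b : R) : Linfty leb f -> Linfty leb g ->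
  Linfty leb (fun x => a * f x + b * g x).
Proof.
move=> /LinftyP[mf [c fc]] /LinftyP[mg [c' gc]]; apply/LinftyP; split.
  by apply: measurable_funD; apply: measurable_funM.
exists (`|a| * c + `|b| * c'); apply: filterS2 fc gc => x hf hg.
by rewrite (le_trans (ler_normD _ _))// !normrM lerD// ler_wpM2l.
Qed.

Lemma Linfty_cst (c : R) : Linfty leb (cst c).
Proof.
by apply/LinftyP; split => //; exists `|c|; apply: nearW => x.
Qed.

Lemma Linfty_affine f (a b : R) : Linfty leb f -> Linfty leb (fun x => a * f x + b).
Proof.
move=> hf; have := Linfty_lin a b hf (Linfty_cst 1).
by congr (Linfty _ _); apply/funext => x/=; rewrite mulr1.
Qed.

(** An everywhere bounded representative, obtained by truncation, is what can be
composed with the process and integrated at every starting point. *)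
Lemma Linfty_bounded_repr f c : 0 <= c -> Linfty leb f -> ae_bounded f c ->
  exists g, [/\ measurable_fun setT g, forall x, `|g x| <= c & f = g %[ae leb]].
Proof.
move=> c0 /LinftyP[mf _] fc.
exists (fun x => Num.max (- c) (Num.min c (f x))); split.
- apply: measurable_maxr => //.
  have -> : (fun x => Num.min c (f x)) = (fun x => - Num.max (- c) (- f x)).
    by apply/funext => x; rewrite -oppr_min opprK.
  apply: measurableT_comp => //; apply: measurable_maxr => //.
  exact: measurableT_comp.
- move=> x; rewrite ler_norml le_max lexx/= ge_max ge_min lexx/= andbT lerNl.
  by rewrite (le_trans _ c0)// oppr_le0.
apply: filterS fc => x; rewrite ler_norml => /andP[h1 h2] _.
by rewrite (min_idPr h2) (max_idPr h1).
Qed.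

Lemma cvg_Linfty (h : nat -> Rn -> R) f (e : nat -> R) : e k @[k --> \oo] --> 0 ->
  (\forall k \near \oo, ae_bounded (fun x => h k x - f x) (e k)) ->
  Linfty_cvg leb h f.
Proof.
move=> e0 he; rewrite /Linfty_cvg.
apply: (@squeeze_cvge _ _ _ _ (cst 0%E) _ (fun k => `|e k|%:E)).
- apply: filterS he => k hk; rewrite Lnorm_ge0/= unlock.
  case: ifPn => _; last exact: (normr_ge0 (e k)).
  by apply/ess_supP; apply: filterS hk => x /= hx; rewrite lee_fin (le_trans hx)// ler_norm.
- exact: cvg_cst.
apply: cvg_EFin; first exact: nearW.
rewrite /comp/=. have := cvg_norm e0; rewrite normr0; exact.
Qed.

(** The indices are shifted because the shift-scale iteration does not normalize
its initial function: only from the first iterate on is it a shift-scale. *)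
Lemma eq_Linfty_cvg (h h' : nat -> Rn -> R) f f' :
  (forall k, h' k.+1 = h k.+1 %[ae leb]) -> f' = f %[ae leb] ->
  Linfty_cvg leb h f -> Linfty_cvg leb h' f'.
Proof.
move=> hh' ff'; apply: cvg_trans; apply: near_eq_cvg; exists 1%N => // -[//|k] _.
rewrite unlock; case: ifPn => // _; apply: eq_ess_sup.
by apply: filterS2 (hh' k) ff' => x E E'; rewrite /comp E// E'.
Qed.

Lemma Linfty_cvg_near (h : nat -> Rn -> R) f (e : R) : 0 < e ->
  Linfty_cvg leb h f ->
  \forall k \near \oo, ae_bounded (fun x => h k x - f x) e.
Proof.
move=> e0 hcvg.
have e0n : nbhs (0%E : \bar R) [set y | (y < e%:E)%E].
  by apply: open_nbhs_nbhs; split; [exact: open_ereal_lt_ereal|exact: e0].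
have : \forall k \near \oo, ('N[leb]_+oo[EFin \o (fun x => h k x - f x)%R] < e%:E)%E
  by exact: hcvg e0n.
apply: filterS => k /ltW hk.
have e0' : (0 <= e%:E)%E by rewrite lee_fin ltW.
by apply: filterS ((Lnormy_le _ e0').1 hk) => x; rewrite lee_fin.
Qed.

Hypothesis leb_gt0 : (0 < leb setT)%E.

Lemma ae_nonempty (Q : Rn -> Prop) : (\forall x \ae leb, Q x) -> exists x, Q x.
Proof.
move=> h. have pf := ae_properfilter_algebraOfSetsType leb_gt0.
exact: (@filter_ex _ _ pf).
Qed.

Definition esup f := fine (ess_supr leb f).
Definition einf f := fine (ess_infr leb f).

Lemma esupE f : Linfty leb f -> ess_supr leb f = (esup f)%:E.
Proof.
move=> /LinftyP[_ [c fc]]; rewrite /esup fineK// fin_numElt; apply/andP; split.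
  apply: (@lt_le_trans _ _ (- c)%:E); first exact: ltNyr.
  apply: ess_sup_gee => //; apply: filterS fc => x.
  by rewrite ler_norml lee_fin => /andP[].
apply: (@le_lt_trans _ _ c%:E); last exact: ltry.
by apply/ess_supP; apply: filterS fc => x /=; rewrite ler_norml lee_fin => /andP[].
Qed.

Lemma esup_ge f : Linfty leb f -> \forall x \ae leb, f x <= esup f.
Proof.
by move=> hf; have := ess_sup_ge leb (EFin \o f); rewrite esupE.
Qed.

Lemma esup_le f c : Linfty leb f -> (\forall x \ae leb, f x <= c) -> esup f <= c.
Proof.
by move=> hf h; rewrite -lee_fin -esupE//; apply/ess_supP; apply: filterS h => x; rewrite lee_fin.
Qed.

Lemma einfN f : einf f = - esup (fun x => - f x).
Proof. by rewrite /einf ess_infEN fineN. Qed.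

Lemma LinftyN f : Linfty leb f -> Linfty leb (fun x => - f x).
Proof.
move=> hf; have := Linfty_affine (-1) 0 hf.
by congr (Linfty _ _); apply/funext => x; rewrite mulN1r addr0.
Qed.

Lemma einf_le f : Linfty leb f -> \forall x \ae leb, einf f <= f x.
Proof.
by move=> /LinftyN/esup_ge; rewrite einfN; apply: filterS => x; rewrite lerNl.
Qed.

Lemma esup_le_shift f g e : Linfty leb f -> Linfty leb g ->
  ae_bounded (fun x => f x - g x) e -> esup f <= esup g + e.
Proof.
move=> hf hg h; apply: esup_le => //; apply: filterS2 (esup_ge hg) h => x.
by rewrite ler_norml => ? /andP[_ ?]; lra.
Qed.

Lemma ae_boundedC f g e : ae_bounded (fun x => f x - g x) e ->
  ae_bounded (fun x => g x - f x) e.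
Proof. by apply: filterS => x; rewrite distrC. Qed.

Lemma esup_dist f g e : Linfty leb f -> Linfty leb g ->
  ae_bounded (fun x => f x - g x) e -> `|esup f - esup g| <= e.
Proof.
move=> hf hg h; rewrite ler_norml.
have := esup_le_shift hf hg h; have := esup_le_shift hg hf (ae_boundedC h); lra.
Qed.

Lemma einf_dist f g e : Linfty leb f -> Linfty leb g ->
  ae_bounded (fun x => f x - g x) e -> `|einf f - einf g| <= e.
Proof.
move=> hf hg h; rewrite !einfN opprK addrC; apply: esup_dist; [exact: LinftyN..|].
by apply: filterS h => x; rewrite opprK addrC.
Qed.

Lemma esup_affine f (a b : R) : 0 < a -> Linfty leb f ->
  esup (fun x => a * f x + b) = a * esup f + b.
Proof.
move=> a0 hf; have haf := Linfty_affine a b hf.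
apply/eqP; rewrite eq_le; apply/andP; split.
  by apply: esup_le => //; apply: filterS (esup_ge hf) => x h; rewrite lerD2r ler_pM2l.
rewrite -lerBrDr mulrC -ler_pdivlMr//; apply: esup_le => //.
by apply: filterS (esup_ge haf) => x h; rewrite ler_pdivlMr// mulrC lerBrDr.
Qed.

Lemma einf_affine f (a b : R) : 0 < a -> Linfty leb f ->
  einf (fun x => a * f x + b) = a * einf f + b.
Proof.
move=> a0 hf; rewrite !einfN.
have -> : (fun x => - (a * f x + b)) = (fun x => a * - f x + - b).
  by apply/funext => x; ring.
rewrite esup_affine//; [ring|exact: LinftyN].
Qed.


Lemma esup_eq f g : f = g %[ae leb] -> esup f = esup g.
Proof.
move=> /ae_eqTP fg; congr fine; apply: eq_ess_sup.
by apply: filterS fg => x /= ->.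
Qed.

Lemma einf_eq f g : f = g %[ae leb] -> einf f = einf g.
Proof.
move=> /ae_eqTP fg; congr fine; apply: eq_ess_inf.
by apply: filterS fg => x /= ->.
Qed.

(** The essential oscillation: the denominator of the shift-scale map, zero
exactly at the a.e. constant functions. *)
Definition osc f := esup f - einf f.

Lemma osc_ge0 f : Linfty leb f -> 0 <= osc f.
Proof.
move=> hf; have [|x] := ae_nonempty (Q := fun x => einf f <= f x <= esup f).
  by apply: filterS2 (einf_le hf) (esup_ge hf) => x -> ->.
by move=> /andP[h1 h2]; rewrite subr_ge0 (le_trans h1).
Qed.

Lemma osc_eq f g : f = g %[ae leb] -> osc f = osc g.
Proof. by move=> fg; rewrite /osc (esup_eq fg) (einf_eq fg). Qed.

Lemma osc_eq0 f : Linfty leb f -> osc f = 0 -> f = cst (esup f) %[ae leb].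
Proof.
move=> hf /eqP; rewrite subr_eq0 => /eqP o0; apply/ae_eqTP.
apply: filterS2 (einf_le hf) (esup_ge hf) => x; rewrite -o0 => h1 h2.
by apply/eqP; rewrite eq_le h1 h2.
Qed.

Lemma osc_cst f c : f = cst c %[ae leb] -> osc f = 0.
Proof.
move=> /osc_eq ->; rewrite /osc /esup /einf ess_sup_cstr// ess_inf_cstr//=.
by rewrite subrr.
Qed.

Lemma osc_dist f g e : Linfty leb f -> Linfty leb g ->
  ae_bounded (fun x => f x - g x) e -> `|osc f - osc g| <= e *+ 2.
Proof.
move=> hf hg h; have := esup_dist hf hg h; have := einf_dist hf hg h.
rewrite /osc !ler_norml => /andP[? ?] /andP[? ?]; apply/andP; split; lra.
Qed.

Lemma osc_affine f (a b : R) : 0 < a -> Linfty leb f ->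
  osc (fun x => a * f x + b) = a * osc f.
Proof. by move=> a0 hf; rewrite /osc esup_affine// einf_affine//; ring. Qed.

Lemma shift_scale_eq f g : f = g %[ae leb] ->
  shift_scale leb f = shift_scale leb g %[ae leb].
Proof.
move=> fg; have := esup_eq fg; have := einf_eq fg; rewrite /esup /einf => ei es.
by apply: filterS fg => x h _; rewrite /shift_scale ei es h.
Qed.

(** Positivity of the factor matters: a negative one would exchange the roles of
the two extrema and replace the result by its complement to 1. *)
Lemma shift_scale_affine f (a b : R) : 0 < a -> Linfty leb f ->
  shift_scale leb (fun x => a * f x + b) = shift_scale leb f.
Proof.
move=> a0 hf; apply/funext => x; rewrite /shift_scale -!/(esup _) -!/(einf _).
rewrite esup_affine// einf_affine//.
have E (y z : R) : a * y + b - (a * z + b) = a * (y - z) by ring.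
by rewrite !E -mulf_div divff ?gt_eqF// mul1r.
Qed.

Lemma shift_scale_affineE f x :
  shift_scale leb f x = (osc f)^-1 * f x + - (einf f / osc f).
Proof. by rewrite /shift_scale -/(esup f) -/(einf f) -/(osc f) mulrBl mulrC. Qed.

Lemma shift_scale_Linfty f : Linfty leb f -> Linfty leb (shift_scale leb f).
Proof.
move=> hf; have := Linfty_affine (osc f)^-1 (- (einf f / osc f)) hf.
by congr (Linfty _ _); apply/funext => x; rewrite shift_scale_affineE.
Qed.

Lemma osc_gt0 f : Linfty leb f -> osc f != 0 -> 0 < osc f.
Proof. by move=> hf o0; rewrite lt_neqAle eq_sym o0 osc_ge0. Qed.

Lemma osc_shift_scale f : Linfty leb f -> osc f != 0 -> osc (shift_scale leb f) = 1.
Proof.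
move=> hf o0; rewrite (funext (shift_scale_affineE f)) osc_affine ?mulVf//.
by rewrite invr_gt0 osc_gt0.
Qed.

Lemma shift_scale01 f : Linfty leb f -> osc f != 0 ->
  \forall x \ae leb, 0 <= shift_scale leb f x <= 1.
Proof.
move=> hf o0; have og := osc_gt0 hf o0.
apply: filterS2 (einf_le hf) (esup_ge hf) => x h1 h2.
rewrite /shift_scale -/(esup f) -/(einf f) -/(osc f).
apply/andP; split; first by rewrite divr_ge0 ?(ltW og)// subr_ge0.
by rewrite ler_pdivrMr// mul1r lerD2r.
Qed.

(** Both extrema are 1-Lipschitz for the sup norm, so away from oscillation 0 the
numerator and the denominator converge. *)
Lemma shift_scale_cvg (h : nat -> Rn -> R) f (e : nat -> R) :
  (forall k, Linfty leb (h k)) -> Linfty leb f -> osc f != 0 ->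
  e k @[k --> \oo] --> 0 ->
  (forall k, ae_bounded (fun x => h k x - f x) (e k)) ->
  Linfty_cvg leb (fun k => shift_scale leb (h k)) (shift_scale leb f).
Proof.
move=> hh hf of0 e0 he.
have cs : esup (h k) @[k --> \oo] --> esup f.
  by apply: cvg_dist_le e0 => k; exact: esup_dist.
have ci : einf (h k) @[k --> \oo] --> einf f.
  by apply: cvg_dist_le e0 => k; exact: einf_dist.
have co : osc (h k) @[k --> \oo] --> osc f by apply: cvgB.
have cV : (osc (h k))^-1 @[k --> \oo] --> (osc f)^-1 by apply: cvgV.
(* The three summands bound the changes of the function, of its infimum and of
the inverse oscillation. *)
pose E k := e k * `|(osc (h k))^-1| + `|einf f - einf (h k)| * `|(osc (h k))^-1|
  + osc f * `|(osc (h k))^-1 - (osc f)^-1|.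
apply: (@cvg_Linfty _ _ E).
  have -> : 0 = 0 * `|(osc f)^-1| + `|einf f - einf f| * `|(osc f)^-1|
    + osc f * `|(osc f)^-1 - (osc f)^-1| :> R by rewrite !subrr normr0; ring.
  apply: cvgD; [apply: cvgD|]; apply: cvgM => //; last 2 first.
  - exact: cvg_cst.
  - by apply: cvg_norm; apply: cvgB => //; exact: cvg_cst.
  - exact: cvg_norm.
  - by apply: cvg_norm; apply: cvgB => //; exact: cvg_cst.
  - exact: cvg_norm.
apply: nearW => k; apply: filterS3 (he k) (einf_le hf) (esup_ge hf) => x h1 h2 h3.
rewrite /shift_scale -!/(esup _) -!/(einf _) -!/(osc _).
have -> : (h k x - einf (h k)) / osc (h k) - (f x - einf f) / osc f =
   (h k x - f x) * (osc (h k))^-1 + (einf f - einf (h k)) * (osc (h k))^-1 +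
   (f x - einf f) * ((osc (h k))^-1 - (osc f)^-1) by ring.
rewrite (le_trans (ler_normD _ _))// lerD//.
  by rewrite (le_trans (ler_normD _ _))// !normrM lerD// ler_wpM2r.
rewrite normrM ler_wpM2r// ger0_norm ?subr_ge0//.
by rewrite /osc lerD2r.
Qed.

End essential_extrema.

(** * Markov operators, the shift-scale map and associated matrices *)

Section markov.
Context {R : realType} {n : nat}.
Local Notation Rn := 'cV[R]_n.
Variable leb : {measure set Rn -> \bar R}.
Hypothesis leb_gt0 : (0 < leb setT)%E.
Implicit Types (K : (Rn -> R) -> Rn -> R) (f g : Rn -> R).

Record markov_operator K : Prop := {
  markov_Linfty : forall f, Linfty leb f -> Linfty leb (K f) ;
  markov_ae : forall f g, Linfty leb f -> Linfty leb g ->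
    f = g %[ae leb] -> K f = K g %[ae leb] ;
  markov_lin : forall f g a b, Linfty leb f -> Linfty leb g ->
    K (fun x => a * f x + b * g x) = (fun x => a * K f x + b * K g x) %[ae leb] ;
  markov1 : K (cst 1) = cst 1 %[ae leb] ;
  markov_contraction : forall f c, 0 <= c -> Linfty leb f ->
    ae_bounded leb f c -> ae_bounded leb (K f) c }.

Lemma markov_iter K m : markov_operator K -> markov_operator (iter m K).
Proof.
move=> hK; elim: m => [|m [IL Ia Il I1 Ic]]; first by split => // *; exact: nearW.
have I1' : Linfty leb (iter m K (cst 1)) by apply/IL/Linfty_cst.
split=> /=.
- by move=> f /IL; exact: markov_Linfty.
- by move=> f g hf hg /(Ia _ _ hf hg); apply: markov_ae => //; exact: IL.
- move=> f g a b hf hg; have := markov_lin hK a b (IL _ hf) (IL _ hg).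
  have := markov_ae hK (IL _ (Linfty_lin a b hf hg))
    (Linfty_lin a b (IL _ hf) (IL _ hg)) (Il _ _ a b hf hg).
  by apply: filterS2 => x h1 h2 _; rewrite h1// h2.
- have := markov_ae hK I1' (Linfty_cst leb 1) I1.
  by apply: filterS2 (markov1 hK) => x h1 h2 _; rewrite h2// h1.
- by move=> f c c0 hf hc; apply: markov_contraction => //; [exact: IL|exact: Ic].
Qed.

Lemma markov_affine K f a b : markov_operator K -> Linfty leb f ->
  K (fun x => a * f x + b) = (fun x => a * K f x + b) %[ae leb].
Proof.
move=> hK hf; have := markov_lin hK a b hf (Linfty_cst leb 1).
have -> : (fun x => a * f x + b * cst 1 x) = (fun x => a * f x + b).
  by apply/funext => x; rewrite mulr1.
by apply: filterS2 (markov1 hK) => x h1 -> // _; rewrite h1// mulr1.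
Qed.

Lemma markov_cst K f c : markov_operator K -> Linfty leb f ->
  f = cst c %[ae leb] -> K f = cst c %[ae leb].
Proof.
move=> hK hf hc; have := markov_ae hK hf (Linfty_affine 0 c hf).
have h0 : f = (fun x => 0 * f x + c) %[ae leb].
  by apply: filterS hc => x h _; rewrite mul0r add0r h.
move=> /(_ h0); apply: filterS2 (markov_affine 0 c hK hf) => x h1 h2 _.
by rewrite h2// h1// mul0r add0r.
Qed.

Lemma iter_eigen K f l m : markov_operator K -> Linfty leb f ->
  K f = (fun x => l * f x) %[ae leb] ->
  iter m K f = (fun x => l ^+ m * f x) %[ae leb].
Proof.
move=> hK hf fl; elim: m => [|m IH]; first by apply: nearW => x _; rewrite mul1r.
have hfm := Linfty_affine (l ^+ m) 0 hf.
have IH' : iter m K f = (fun x => l ^+ m * f x + 0) %[ae leb].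
  by apply: filterS IH => x h _; rewrite addr0 h.
have := markov_ae hK (markov_Linfty (markov_iter m hK) hf) hfm IH'.
apply: filterS3 fl (markov_affine (l ^+ m) 0 hK hf) => x h1 h2 h3 _ /=.
by rewrite h3// h2// h1// addr0 mulrA exprSr.
Qed.

(** Since K commutes with affine changes, an inner shift-scale is absorbed by the
outer one. *)
Lemma shift_scale_markov K f : markov_operator K -> Linfty leb f -> osc leb f != 0 ->
  shift_scale leb (K (shift_scale leb f)) = shift_scale leb (K f) %[ae leb].
Proof.
move=> hK hf of0; have og : 0 < (osc leb f)^-1 by rewrite invr_gt0 osc_gt0.
rewrite (funext (shift_scale_affineE leb f)).
rewrite -(shift_scale_affine leb_gt0 (- (einf leb f / osc leb f)) og (markov_Linfty hK hf)).
exact: shift_scale_eq (markov_affine _ _ hK hf).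
Qed.

Lemma eigenfunction_fixed_point K f l : markov_operator K -> Linfty leb f ->
  osc leb f != 0 -> 0 < l -> K f = (fun x => l * f x) %[ae leb] ->
  shift_scale leb (K (shift_scale leb f)) = shift_scale leb f %[ae leb].
Proof.
move=> hK hf of0 l0 fl; apply: ae_eq_trans (shift_scale_markov hK hf of0) _.
rewrite -(shift_scale_affine leb_gt0 0 l0 hf); apply: shift_scale_eq.
by apply: filterS fl => x E _; rewrite E// addr0.
Qed.

Lemma mul_chi_of (S : 'M[R]_2) f x i :
  (S *m chi_of f x) i 0 = S i 0 * f x + S i 1 * (1 - f x).
Proof.
rewrite mxE !big_ord_recl big_ord0 !mxE/= addr0.
by have -> : lift ord0 ord0 = 1 :> 'I_2 by apply/val_inj.
Qed.

(** The rows of the difference of the matrices give affine relations satisfied by f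
almost everywhere, and a nonconstant f satisfies only the trivial one. *)
Lemma mul_chi_of_inj (S S' : 'M[R]_2) f : Linfty leb f -> osc leb f != 0 ->
  (\forall x \ae leb, S *m chi_of f x = S' *m chi_of f x) -> S = S'.
Proof.
move=> hf of0 hS; apply/matrixP => i j.
pose p j := S i j - S' i j.
have hp : \forall x \ae leb, (p 0 - p 1) * f x + p 1 = 0.
  apply: filterS hS => x /colP/(_ i); rewrite !mul_chi_of => /eqP.
  by rewrite -subr_eq0 => /eqP <-; rewrite /p; ring.
have p01 : p 0 = p 1.
  apply/eqP; rewrite -subr_eq0; apply/negP => /negP p0; move/eqP: of0; apply.
  apply: (osc_cst leb_gt0 (c := - p 1 / (p 0 - p 1))).
  apply: filterS hp => x /eqP; rewrite addr_eq0 => /eqP E _.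
  by apply: (mulfI p0); rewrite E/= [RHS]mulrC divfK.
have [x] := ae_nonempty leb_gt0 hp; rewrite p01 subrr mul0r add0r => p1.
apply/eqP; rewrite -subr_eq0 -/(p j).
have [->|->] : j = 0 \/ j = 1.
  by case: j => -[|[|//]] ?; [left|right]; apply/val_inj.
- by rewrite p01 p1.
- by rewrite p1.
Qed.

(** With m, M the extrema and D = M - m, the entries are read off from
f - m = (1 - m) f - m (1 - f) and M - f = (M - 1) f + M (1 - f), divided by D. *)
Lemma associated_matrix_exists f : osc leb f != 0 ->
  exists S, associated_matrix leb f S.
Proof.
move=> of0; pose m := einf leb f; pose M := esup leb f; pose D := osc leb f.
pose S (i j : 'I_2) := (if i == 0 then if j == 0 then 1 - m else - m
   else if j == 0 then M - 1 else M) / D.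
exists (\matrix_(i, j) S i j); apply: nearW => x; apply/colP => i.
rewrite mul_chi_of !mxE /S/= shift_scale_affineE -/D -/m.
have ME : M = D + m by rewrite /D /osc subrK.
by case: ifP => _; rewrite ?ME; field.
Qed.

Lemma componentwise_chi_of K f : markov_operator K -> Linfty leb f ->
  \forall x \ae leb, componentwise K (chi_of f) x = chi_of (K f) x.
Proof.
move=> hK hf; apply: filterS (markov_affine (-1) 1 hK hf) => x E.
apply/colP => i; rewrite !mxE; case: ifP => i0.
  by congr K; apply/funext => y; rewrite mxE i0.
rewrite -[RHS]addrC -mulN1r -E//; congr K.
by apply/funext => y; rewrite mxE i0 mulN1r addrC.
Qed.

(** * Powers of a Markov operator with dominant spectrum *)

Section dominant.
Variables (K : (Rn -> R) -> Rn -> R) (T : R) (q : nat -> R) (v : nat -> Rn -> R).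
Hypotheses (hK : markov_operator K) (T0 : 0 < T).
Hypothesis hv : dominant_spectrum leb K T q v.

Let lam i := expR (T * q i).

Lemma lam_gt0 i : 0 < lam i. Proof. exact: expR_gt0. Qed.

Lemma Linfty_sum (a : nat -> R) N : Linfty leb (fun x => \sum_(i < N) a i * v i x).
Proof.
elim: N => [|N IH].
  have := Linfty_cst leb 0; congr (Linfty _ _); apply/funext => x.
  by rewrite big_ord0.
have := Linfty_lin 1 (a N) IH (spec_Linfty hv N).
by congr (Linfty _ _); apply/funext => x; rewrite big_ord_recr/= mul1r.
Qed.

Lemma iter_sum (a : nat -> R) m N :
  iter m K (fun x => \sum_(i < N) a i * v i x) =
  (fun x => \sum_(i < N) a i * (lam i ^+ m * v i x)) %[ae leb].
Proof.
have hKm := markov_iter m hK.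
elim: N => [|N IH].
  have := markov_cst hKm (Linfty_cst leb 0) (ae_eq_refl _ _ _).
  have -> : (fun x => \sum_(i < 0) a i * v i x) = cst 0 :> (Rn -> R).
    by apply/funext => x; rewrite big_ord0.
  by apply: filterS => x h _; rewrite h// big_ord0.
have -> : (fun x => \sum_(i < N.+1) a i * v i x) =
    (fun x => 1 * (\sum_(i < N) a i * v i x) + a N * v N x).
  by apply/funext => x; rewrite big_ord_recr/= mul1r.
apply: filterS3 (markov_lin hKm 1 (a N) (Linfty_sum a N) (spec_Linfty hv N)) IH
  (iter_eigen m hK (spec_Linfty hv N) (spec_eigen hv N)) => x h1 h2 h3 _.
by rewrite h1// h2// h3// mul1r big_ord_recr.
Qed.

(** Markov operators fix constants, so a nonzero constant has eigenvalue 1, while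
the eigenvalue of [v 1] is smaller. *)
Lemma osc_v1 : osc leb (v 1) != 0.
Proof.
apply/eqP => /(osc_eq0 leb_gt0 (spec_Linfty hv 1)) h.
have h' := markov_cst hK (spec_Linfty hv 1) h.
apply: (spec_neq0 hv (i := 1%N)); set c := esup leb (v 1) in h h'.
apply: filterS3 h h' (spec_eigen hv 1) => x h1 h2 h3 _.
have := h3 I; rewrite h2// h1// => /eqP.
rewrite -[X in X == _]mul1r -subr_eq0 -mulrBl mulf_eq0 subr_eq0 => /orP[/eqP l1|/eqP->//].
have : lam 1 < 1 by rewrite expR_lt1 pmulr_rlt0// -(spec_q1 hv); exact: spec_q12 hv.
by rewrite /lam -l1 ltxx.
Qed.

Variables (a : nat -> R) (f0 : Rn -> R).
Hypothesis hf0 : Linfty leb f0.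
Hypothesis ha : eigendecomposition leb v a f0.

(** Eventually the partial sums are within 1 of the sum; the finitely many others
are bounded one by one. *)
Lemma partial_sums_bounded : exists2 C, 0 <= C &
  forall N, ae_bounded leb (fun x => \sum_(i < N) a i * v i x) C.
Proof.
have [N0 _ hN0] := Linfty_cvg_near ltr01 ha.
have /LinftyP[_ [c hc]] := hf0.
suff [C hC] : exists C, forall N, ae_bounded leb (fun x => \sum_(i < N) a i * v i x) C.
  exists (Num.max 0 C) => [|N]; first by rewrite le_max lexx.
  by apply: filterS (hC N) => x h; rewrite le_max h orbT.
have [C hC] : exists C, forall N, (N < N0)%N ->
    ae_bounded leb (fun x => \sum_(i < N) a i * v i x) C.
  elim: (N0) => [|M [C hC]]; first by exists 0.
  have /LinftyP[_ [c' hc']] := Linfty_sum a M.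
  exists (Num.max C c') => N; rewrite ltnS leq_eqVlt => /orP[/eqP->|/hC].
    by apply: filterS hc' => x h; rewrite le_max h orbT.
  by apply: filterS => x h; rewrite le_max h.
exists (Num.max C (1 + c)) => N; have [/hC|h] := ltnP N N0.
  by apply: filterS => x h; rewrite le_max h.
apply: filterS2 (hN0 _ h) hc => x h1 h2.
rewrite le_max; apply/orP; right.
by rewrite -[X in `|X|](subrK (f0 x)) (le_trans (ler_normD _ _))// lerD.
Qed.

(** The constant is that of Abel summation for the partial sums starting at i = 2,
each a difference of two bounded partial sums, plus 1 for truncating the
series. *)
Lemma power_expansion : exists C, forall m,
  ae_bounded leb (fun x => iter m K f0 x - (a 0%N + lam 1 ^+ m * (a 1%N * v 1 x)))
    (C * lam 2 ^+ m).
Proof.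
have [C C0 hC] := partial_sums_bounded; exists (C *+ 2 + 1) => m.
have hKm := markov_iter m hK.
have l2 : 0 < lam 2 ^+ m by rewrite exprn_gt0// lam_gt0.
(* For each m the series is cut so late that, K^m being a contraction, the
truncation error is at most the target rate l_2^m. *)
have [N0 _ hN0] := Linfty_cvg_near l2 ha.
pose N := N0.+2; have /hN0 hN : (N0 <= N)%N by exact/leqW/leqnSn.
have close : ae_bounded leb
    (fun x => iter m K (fun x => \sum_(i < N) a i * v i x) x - iter m K f0 x)
    (lam 2 ^+ m).
  have hd := Linfty_lin 1 (-1) (Linfty_sum a N) hf0.
  have hb : ae_bounded leb (fun x => 1 * (\sum_(i < N) a i * v i x) + -1 * f0 x)
      (lam 2 ^+ m).
    by apply: filterS hN => x; rewrite mul1r mulN1r.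
  have := markov_contraction hKm (ltW l2) hd hb.
  apply: filterS2 (markov_lin hKm 1 (-1) (Linfty_sum a N) hf0) => x h1.
  by rewrite h1// mul1r mulN1r.
have hCN := ae_foralln hC.
near=> x.
have e1 : iter m K (fun x => \sum_(i < N) a i * v i x) x =
    \sum_(i < N) a i * (lam i ^+ m * v i x).
  by near: x; apply: filterS (iter_sum a m N) => x ->.
have e0 : v 0 x = 1 by near: x; apply: filterS (spec_v1 hv) => x ->.
have hx : forall N, `|\sum_(i < N) a i * v i x| <= C by near: x.
have hcl : `|iter m K (fun x => \sum_(i < N) a i * v i x) x - iter m K f0 x|
  <= lam 2 ^+ m by near: x.
have tail : `|\sum_(i < N0) lam i.+2 ^+ m * (a i.+2 * v i.+2 x)| <= lam 2 ^+ m * (C *+ 2).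
  apply: (@abel_sum_le _ (fun i => lam i.+2 ^+ m) (fun i => a i.+2 * v i.+2 x)).
  - by move=> i; rewrite exprn_ge0// ltW// lam_gt0.
  - move=> i; rewrite lerXn2r ?nnegrE ?(ltW (lam_gt0 _))// ler_expR ler_pM2l//.
    exact: spec_q_noninc hv _.
  - move=> M; have := hx M.+2; have := hx 2%N.
    rewrite !big_ord_recl/= big_ord0 addr0 !ler_norml.
    move=> /andP[? ?] /andP[? ?]; apply/andP; split; lra.
move: hcl; rewrite e1 !big_ord_recl/= e0 /lam (spec_q1 hv) mulr0 expR0 expr1n !mulr1.
have -> : \sum_(i < N0) a (lift ord0 (lift ord0 i)) *
   (expR (T * q (lift ord0 (lift ord0 i))) ^+ m * v (lift ord0 (lift ord0 i)) x)
   = \sum_(i < N0) lam i.+2 ^+ m * (a i.+2 * v i.+2 x).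
  by apply: eq_bigr => i _; rewrite /= mulrCA.
move: tail; rewrite -!/(lam _) !ler_norml.
set S := \sum_(i < _) _; move: (iter m K f0 x) (lam 2 ^+ m) (lam 1 ^+ m) => u l l'.
move=> /andP[? ?] /andP[? ?].
apply/andP; split; lra.
Unshelve. all: by end_near. Qed.

Hypothesis a1 : a 1%N != 0.

Let g x := a 1%N * v 1 x.

(** [h m] is l_1^-m (K^m f0 - a_0), written as an affine function of K^m f0 so that
the affine lemmas apply syntactically. *)
Let h m x := (lam 1 ^+ m)^-1 * iter m K f0 x + - (a 0%N / lam 1 ^+ m).

Lemma Linfty_h m : Linfty leb (h m).
Proof. by apply: Linfty_affine; exact: markov_Linfty (markov_iter m hK) _ hf0. Qed.

Lemma Linfty_g : Linfty leb g.
Proof.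
have := Linfty_affine (a 1%N) 0 (spec_Linfty hv 1).
by congr (Linfty _ _); apply/funext => x; rewrite addr0.
Qed.

Lemma rescaled_cvg : exists2 e : nat -> R, e k @[k --> \oo] --> 0 &
  forall m, ae_bounded leb (fun x => h m x - g x) (e m).
Proof.
have [C hC] := power_expansion.
exists (geometric C (lam 2 / lam 1)) => [|m].
  apply: cvg_geometric; rewrite ger0_norm ?divr_ge0 ?ltW ?lam_gt0//.
  rewrite ltr_pdivrMr ?lam_gt0// mul1r ltr_expR ltr_pM2l//; exact: spec_gap hv.
have l1 : 0 < lam 1 ^+ m by rewrite exprn_gt0// lam_gt0.
apply: filterS (hC m) => x hx.
have -> : h m x - g x = (lam 1 ^+ m)^-1 *
    (iter m K f0 x - (a 0%N + lam 1 ^+ m * (a 1%N * v 1 x))).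
  by rewrite /h /g; field; rewrite gt_eqF.
rewrite normrM ger0_norm ?invr_ge0 ?(ltW l1)// /geometric/= expr_div_n.
by rewrite [leLHS]mulrC [leRHS]mulrA ler_pM2r ?invr_gt0.
Qed.

Lemma osc_g : osc leb g != 0.
Proof.
apply/eqP => /(osc_eq0 leb_gt0 Linfty_g) h0; move/eqP: osc_v1; apply.
apply: (osc_cst leb_gt0 (c := (a 1%N)^-1 * esup leb g)).
by apply: filterS h0 => x hx _; rewrite /= in hx *; rewrite -hx// /g mulKf.
Qed.

(** If K^m f0 were constant, so would be all K^(k+m) f0 and hence all [h (k + m)],
whose oscillations tend to that of [g]. *)
Lemma osc_iter m : osc leb (iter m K f0) != 0.
Proof.
apply/eqP => o0; have [e e0 he] := rescaled_cvg.
have oh k : osc leb (h (k + m)) = 0.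
  rewrite osc_affine ?invr_gt0 ?exprn_gt0 ?lam_gt0//; last first.
    exact: markov_Linfty (markov_iter _ hK) _ hf0.
  have hm := markov_Linfty (markov_iter m hK) hf0.
  have := markov_cst (markov_iter k hK) hm (osc_eq0 leb_gt0 hm o0).
  by rewrite -iterD => /(osc_cst leb_gt0) ->; rewrite mulr0.
have : (cst 0 : nat -> R) k @[k --> \oo] --> osc leb g.
  apply: (@cvg_dist_le _ _ (fun k => e (k + m)%N *+ 2)) => [k|].
    by rewrite -[X in `|X - _|]/(0 : R) -(oh k); apply: osc_dist => //;
      [exact: Linfty_h|exact: Linfty_g].
  have em : e (k + m)%N @[k --> \oo] --> 0 by rewrite (cvg_shiftn m e).
  have := cvgD em em; rewrite addr0; exact.
move=> hc; have og : osc leb g = 0 := cvg_unique (@norm_hausdorff _ _) hc (cvg_cst 0).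
by move: osc_g; rewrite og eqxx.
Qed.

Lemma shift_scale_h m : shift_scale leb (h m) = shift_scale leb (iter m K f0).
Proof.
have l1 : 0 < (lam 1 ^+ m)^-1 by rewrite invr_gt0 exprn_gt0// lam_gt0.
have hm := markov_Linfty (markov_iter m hK) hf0.
exact (shift_scale_affine leb_gt0 (- (a 0%N / lam 1 ^+ m)) l1 hm).
Qed.

Lemma iterates_Linfty m : Linfty leb (iterates leb K f0 m).
Proof. by elim: m => [//|m IH]; exact/shift_scale_Linfty/(markov_Linfty hK). Qed.

Lemma iteratesE m : iterates leb K f0 m.+1 =
  shift_scale leb (iter m.+1 K f0) %[ae leb].
Proof.
elim: m => [|m IH]; first exact: ae_eq_refl.
have hm := markov_Linfty (markov_iter m.+1 hK) hf0.
apply: ae_eq_trans (shift_scale_markov hK hm (osc_iter m.+1)).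
apply: shift_scale_eq.
exact: (markov_ae hK (iterates_Linfty m.+1) (shift_scale_Linfty hm) IH).
Qed.

Lemma iterates_cvg : Linfty_cvg leb (iterates leb K f0) (shift_scale leb g).
Proof.
have [e e0 he] := rescaled_cvg.
have := shift_scale_cvg leb_gt0 Linfty_h Linfty_g osc_g e0 he.
apply: eq_Linfty_cvg => [k|]; last exact: ae_eq_refl.
by apply: filterS (iteratesE k) => x hx _; rewrite hx// shift_scale_h.
Qed.

End dominant.
End markov.

(** * The Koopman operator *)

Section koopman.
Context {R : realType} {n : nat} {d : measure_display} {Om : measurableType d}.
Local Notation Rn := 'cV[R]_n.
Variables (leb : {measure set Rn -> \bar R}) (P : probability Om R).
Variables (X : Rn -> R -> Om -> Rn) (t : R).
Hypothesis mX : forall x, measurable_fun setT (X x t).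

Lemma koopmanE f x : koopman P X t f x = \int[P]_w f (X x t w).
Proof. by rewrite /koopman unlock. Qed.

Lemma bounded_integrable (f : Rn -> R) c x : measurable_fun setT f ->
  (forall y, `|f y| <= c) -> P.-integrable setT (EFin \o (fun w => f (X x t w))).
Proof.
move=> mf fc; apply: measurable_bounded_integrable => //.
- by rewrite (le_lt_trans (probability_le1 _ _))// ltry.
- by apply: measurableT_comp mf (mX x).
by exists c; split; [exact: num_real|move=> M cM w _; exact: le_trans (fc _) (ltW cM)].
Qed.

(** The expectation defining the operator is taken along the process for a fixed
function, whereas elements of L^oo are bounded only almost everywhere for the
Lebesgue measure.  Compatibility of the operator with a.e. equality allows
passing to bounded representatives, for which the identities hold at every
point. *)
Lemma koopman_markov : Linfty_operator leb (koopman P X t) ->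
  markov_operator leb (koopman P X t).
Proof.
move=> [KL Kae].
have brep f : Linfty leb f -> exists (g : Rn -> R) (c : R), [/\ measurable_fun setT g,
    forall y, `|g y| <= c, Linfty leb g & f = g %[ae leb]].
  move=> hf; have /LinftyP[_ [c hc]] := hf.
  have c0 : 0 <= Num.max 0 c by rewrite le_max lexx.
  have [|g [mg gc fg]] := Linfty_bounded_repr c0 hf.
    by apply: filterS hc => x h; rewrite le_max h orbT.
  exists g, (Num.max 0 c); split => //; apply/LinftyP; split => //.
  by exists (Num.max 0 c); exact: nearW.
split => //.
- move=> f g a b hf hg.
  have [f' [cf [mf bf hf' ff']]] := brep _ hf.
  have [g' [cg [mg bg hg' gg']]] := brep _ hg.
  have ffgg : (fun x => a * f x + b * g x) =
      (fun x => a * f' x + b * g' x) %[ae leb].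
    by apply: filterS2 ff' gg' => x E1 E2 _; rewrite E1// E2.
  apply: filterS3 (Kae _ _ (Linfty_lin a b hf hg) (Linfty_lin a b hf' hg') ffgg)
    (Kae _ _ hf hf' ff') (Kae _ _ hg hg' gg') => x -> // -> // -> // _.
  have If := bounded_integrable x mf bf; have Ig := bounded_integrable x mg bg.
  rewrite !koopmanE RintegralD//; last 2 first.
  - exact: integrableZl If.
  - exact: integrableZl Ig.
  by rewrite !RintegralZl.
- by apply: nearW => x _; rewrite koopmanE Rintegral_cst//= probability_setT mulr1.
move=> f c c0 hf fc; have [g [mg gc fg]] := Linfty_bounded_repr c0 hf fc.
have hg : Linfty leb g by apply/LinftyP; split => //; exists c; exact: nearW.
apply: filterS (Kae _ _ hf hg fg) => x -> //; rewrite koopmanE.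
have Ig := bounded_integrable x mg gc.
rewrite (le_trans (le_normr_Rintegral _ _))//.
have -> : c = \int[P]_w cst c w by rewrite Rintegral_cst//= probability_setT mulr1.
apply: le_Rintegral => //.
  exact: integrable_norm Ig.
exact: finite_measure_integrable_cst.
Qed.

End koopman.

(** * Convergence of the shift-scale iteration *)

Lemma shift_scale_iteration_cvg (R : realType) (n : nat) (leb : {measure set 'cV[R]_n -> \bar R})
  (leb_gt0 : (0 < leb setT)%E) (K : ('cV[R]_n -> R) -> 'cV[R]_n -> R)
  (hK : markov_operator leb K) (T : R) (T0 : 0 < T) (q : nat -> R)
  (v : nat -> 'cV[R]_n -> R) (hv : dominant_spectrum leb K T q v)
  (f0 : 'cV[R]_n -> R) (hf0 : Linfty leb f0)
  (a : nat -> R) (ha : eigendecomposition leb v a f0) (a1 : a 1%N != 0) :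
  exists alpha beta : R,
    let chibar := fun x => alpha * v 0%N x + beta * v 1%N x in
    [/\ Linfty_cvg leb (iterates leb K f0) chibar,
        chi_function leb K (chi_of chibar),
        chibar = shift_scale leb (K chibar) %[ae leb] &
        exists S : 'M[R]_2,
          [/\ associated_matrix leb (K chibar) S,
              forall S', associated_matrix leb (K chibar) S' -> S' = S &
              solves_chi leb K S (chi_of chibar)]].
Proof.
pose g x := a 1%N * v 1%N x.
have hg : Linfty leb g := Linfty_g hv a.
have og : osc leb g != 0 := osc_g leb_gt0 hK T0 hv a1.
exists (- (einf leb g / osc leb g)), (a 1%N / osc leb g) => w.
have wg : w = shift_scale leb g %[ae leb].
  apply: filterS (spec_v1 hv) => x v1 _; rewrite shift_scale_affineE /w v1// /g/=.
  by rewrite mulr1 addrC mulrAC mulrC.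
have hw : Linfty leb w.
  exact: Linfty_lin (spec_Linfty hv 0) (spec_Linfty hv 1).
have hsg := shift_scale_Linfty hg.
have Kw : K w = K (shift_scale leb g) %[ae leb] := markov_ae hK hw hsg wg.
have hKw := markov_Linfty hK hw.
have fix_w : w = shift_scale leb (K w) %[ae leb].
  have Kg : K g = (fun x => expR (T * q 1%N) * g x) %[ae leb].
    have := markov_affine (a 1%N) 0 hK (spec_Linfty hv 1).
    have -> : (fun x => a 1%N * v 1%N x + 0) = g by apply/funext => x; rewrite addr0.
    apply: filterS2 (spec_eigen hv 1) => x E1 E2 _.
    by rewrite E2// E1// addr0 mulrCA.
  apply: ae_eq_trans wg _; apply: ae_eq_sym.
  apply: ae_eq_trans (eigenfunction_fixed_point leb_gt0 hK hg og (expR_gt0 _) Kg).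
  exact: shift_scale_eq.
have oKw : osc leb (K w) != 0.
  apply/negP => /eqP /(osc_eq0 leb_gt0 hKw) cKw.
  have : osc leb w = 0.
    apply: (osc_cst leb_gt0 (c := (osc leb (K w))^-1 * esup leb (K w)
                                  + - (einf leb (K w) / osc leb (K w)))).
    apply: filterS2 fix_w cKw => x E1 E2 _.
    by rewrite E1// shift_scale_affineE E2.
  by rewrite (osc_eq wg) osc_shift_scale// => /eqP; rewrite oner_eq0.
have [S hS] := associated_matrix_exists oKw.
have solS : solves_chi leb K S (chi_of w).
  apply: filterS3 hS (componentwise_chi_of hK hw) fix_w => x E1 -> E2.
  by rewrite E1; apply/colP => i; rewrite !mxE E2.
split => //.
- apply: eq_Linfty_cvg wg (iterates_cvg leb_gt0 hK T0 hv hf0 ha a1).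
  by move=> k; exact: ae_eq_refl.
- split; last by exists S.
    apply: filterS2 (shift_scale01 leb_gt0 hKw oKw) fix_w => x w01 E i.
    rewrite mxE -E// in w01 *; case: ifP => // _.
    by move: w01 => /andP[? ?]; apply/andP; split; lra.
  by apply: nearW => x; rewrite !big_ord_recl big_ord0 !mxE/= addr0 addrC subrK.
exists S; split => // S' hS'.
apply: (mul_chi_of_inj leb_gt0 hKw oKw).
by apply: filterS2 hS hS' => x -> ->.
Qed.

Theorem theorem1 (R : realType) (n : nat)
  (leb : {measure set 'cV[R]_n -> \bar R}) (hleb : is_lebesgue leb)
  (d : measure_display) (Om : measurableType d) (P : probability Om R)
  (U : 'cV[R]_n -> R) (hU : smooth U) (sigma : 'M[R]_n)
  (B : R -> Om -> 'cV[R]_n) (hB : brownian_motion P B)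
  (X : 'cV[R]_n -> R -> Om -> 'cV[R]_n)
  (hX : diffusion P U sigma B X) (hrev : reversible P X)
  (T : R) (hT : 0 < T) (hK : Linfty_operator leb (koopman P X T))
  (q : nat -> R) (v : nat -> 'cV[R]_n -> R)
  (hv : dominant_spectrum leb (koopman P X T) T q v)
  (chi0 : 'cV[R]_n -> R) (hchi0 : Linfty leb chi0)
  (a : nat -> R) (ha : eigendecomposition leb v a chi0)
  (ha1 : a 0%N != 0) (ha2 : a 1%N != 0) :
  exists alpha beta : R,
    let K := koopman P X T in
    let chibar := fun x => alpha * v 0%N x + beta * v 1%N x in
    [/\ Linfty_cvg leb (iterates leb K chi0) chibar,
        chi_function leb K (chi_of chibar),
        chibar = shift_scale leb (K chibar) %[ae leb] &
        exists S : 'M[R]_2,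
          [/\ associated_matrix leb (K chibar) S,
              forall S', associated_matrix leb (K chibar) S' -> S' = S &
              solves_chi leb K S (chi_of chibar)]].
Proof.
have leb_gt0 : (0 < leb setT)%E.
  rewrite lt_neqAle measure_ge0 andbT; apply/negP => /eqP l0.
  by apply: (spec_neq0 hv (i := 0%N)); exists setT; split => //; exact/esym.
have mX x : measurable_fun setT (X x T) by apply: (diff_measurable hX); exact: ltW.
exact: (shift_scale_iteration_cvg leb_gt0 (koopman_markov mX hK) hT hv hchi0 ha ha2).
Qed.
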